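(* Let $(X,\mu)$ be a positive $\sigma$-finite measure space. Let $f_0:X\to\mathbb{R}^+$ be a positive probability density with respect to $\mu$, i.e. $\int_X f_0(x)\,d\mu(x)=1$ and $f_0(x)>0$ for every $x\in X$. Let $g_0:X\to\mathbb{R}$ be an integrable function, i.e. $\int_X|g_0|\,d\mu<\infty$, such that (a) $\int_X g_0(x)\,d\mu(x)=0$; (b) $\int_X\frac{g_0^2(x)}{f_0(x)}\,d\mu(x)=1$, i.e. $\frac{g_0^2}{f_0}$ is a probability density with respect to $\mu$. Then the function $f:X\times\mathbb{R}\to\mathbb{R}$ given by $$f(x,t)=\alpha(x)\cos^2\Bigl(\frac t2-\beta(x)\Bigr),$$ where $\alpha(x)=\frac{f_0^2(x)+g_0^2(x)}{f_0(x)}$ and $\beta(x)=\tan^{-1}\frac{g_0(x)}{f_0(x)}$, satisfies the following properties: (i) for every $x\in X$ the function of $t$ given by $y(t)=f(x,t)$ solves the initial value problem $2y\ddot y+y^2-(\dot y)^2=0$, $y(0)=f_0(x)$, $\dot y(0)=g_0(x)$; (ii) $\int_X f(x,t)\,d\mu(x)=1$ for every $t$, i.e. $f(\cdot,t)$ is a probability density for every $t\in\mathbb{R}$; (iii) $\int_X\frac{(\dot f(x,t))^2}{f(x,t)}\,d\mu(x)=1$ for every $t$, i.e. $\frac{(\dot f(\cdot,t))^2}{f(\cdot,t)}$ is a probability density for every $t\in\mathbb{R}$.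
   Context: Dots denote derivatives with respect to $t$; in particular $\dot f=\partial f/\partial t$. $\tan^{-1}$ is the arctangent. A probability density with respect to $\mu$ is a nonnegative function on $X$ whose integral with respect to $\mu$ is $1$.
   Formalization: In (iii), where f(x,t)=0 (possibly on a set of positive measure, where the quotient is 0/0), the quotient of the squared t-derivative of f by f is read as its limit as s tends to t, whose existence is also proved; elsewhere it is the literal quotient. *)

(* Defs.v *)
(* MathComp-Analysis; the reals are an arbitrary [R : realType]. *)
From HB Require Import structures.
From mathcomp Require Import all_boot all_order all_algebra.
From mathcomp Require Import all_classical all_reals all_analysis.
Set Implicit Arguments.
Unset Strict Implicit.
Unset Printing Implicit Defensive.
Import Order.TTheory GRing.Theory Num.Theory.
Import numFieldNormedType.Exports.
Local Open Scope classical_set_scope.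
Local Open Scope ring_scope.

(* Measurability is explicit because the library integral is total. *)
Definition is_density (R : realType) (d : measure_display)
    (X : measurableType d) (mu : {measure set X -> \bar R}) (h : X -> R) : Prop :=
  [/\ measurable_fun [set: X] h,
      (forall x, 0 <= h x) &
      (\int[mu]_(x in [set: X]) (h x)%:E = 1)%E].

Section Curve.
Variables (R : realType) (X : Type) (f0 g0 : X -> R).

Definition alpha (x : X) : R := (f0 x ^+ 2 + g0 x ^+ 2) / f0 x.

Definition beta (x : X) : R := atan (g0 x / f0 x).

Definition curve (x : X) (t : R) : R := alpha x * cos (t / 2 - beta x) ^+ 2.

End Curve.

Definition solves_ivp (R : realType) (a b : R) (y : R -> R) : Prop :=
  [/\ (forall t, derivable y t 1),
      (forall t, derivable (derive1 y) t 1),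
      (forall t, 2 * y t * derive1 (derive1 y) t + y t ^+ 2 - derive1 y t ^+ 2 = 0),
      y 0 = a &
      derive1 y 0 = b].

Definition fisher_raw (R : realType) (y : R -> R) (s : R) : R :=
  derive1 y s ^+ 2 / y s.

(* y'^2 / y, extended by its limit to the zeros of y.  The function
   t |-> curve f0 g0 x t has isolated zeros, at which its derivative vanishes
   as well, so that y'^2 / y has the form 0/0 there.  For a fixed t the set of
   x with curve f0 g0 x t = 0 may have positive measure, so the value of the
   quotient on it matters; the library value 0/0 = 0 would be wrong. *)
Definition fisher (R : realType) (y : R -> R) (t : R) : R :=
  if y t == 0 then lim (fisher_raw y s @[s --> t^']) else fisher_raw y t.

(* Main.v *)
Require Import Defs.
From HB Require Import structures.
From mathcomp Require Import all_boot all_order all_algebra.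
From mathcomp Require Import all_classical all_reals all_analysis.
From mathcomp Require Import measurable_realfun.
From mathcomp Require Import ring lra.
Import Order.TTheory GRing.Theory Num.Theory.
Import numFieldNormedType.Exports.
Local Open Scope classical_set_scope.
Local Open Scope ring_scope.

(** Put theta = t/2 - beta(x).  Differentiating alpha cos^2 theta gives
    y' = - alpha cos theta sin theta and
    y'' = - (alpha/2) (cos^2 theta - sin^2 theta), and the differential equation
    is then a polynomial identity in cos theta and sin theta.

    The rest comes from getting rid of the arctangent.  Since
    sin beta = (g0/f0) cos beta and alpha cos^2 beta = f0, the addition formula
    turns the curve into f0 (p + (g0/f0) q)^2 with p = cos (t/2) and
    q = sin (t/2) ([curveE]), that is, p^2 f0 + 2 p q g0 + q^2 (g0^2/f0).  The
    three functions have integrals 1, 0 and 1, so the total mass is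
    p^2 + q^2 = 1 ([density_square_combination]).

    Where y does not vanish, y'^2 / y = alpha sin^2 theta.  A zero of y is an
    isolated zero of cos theta, so the value of y'^2 / y extended by its limit
    is alpha sin^2 theta there too ([fisher_cos2]).  As
    sin^2 theta = cos^2 (theta + pi/2), this is the curve itself at time t + pi,
    and its integral has just been computed. *)

(** * Derivatives of the squared cosine *)

Lemma is_derive_half_shift {R : realType} (b t : R) :
  is_derive t 1 (fun s : R => s / 2 - b) 2^-1.
Proof.
have -> : (fun s : R => s / 2 - b) = (2^-1 \*: id - cst b).
  by apply/funext => s /=; rewrite fctE mulrC.
apply: is_derive_eq.
by rewrite subr0 /GRing.scale /= mulr1.
Qed.

Lemma is_derive_cos_half {R : realType} (b t : R) :
  is_derive t 1 (fun s : R => cos (s / 2 - b)) (- sin (t / 2 - b) * 2^-1).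
Proof.
have := is_derive1_comp (f := cos) (g := fun s : R => s / 2 - b) _
  (is_derive_half_shift b t); exact.
Qed.

Lemma is_derive_sin_half {R : realType} (b t : R) :
  is_derive t 1 (fun s : R => sin (s / 2 - b)) (cos (t / 2 - b) * 2^-1).
Proof.
have := is_derive1_comp (f := sin) (g := fun s : R => s / 2 - b) _
  (is_derive_half_shift b t); exact.
Qed.

Lemma is_derive_cos2 {R : realType} (a b t : R) :
  is_derive t 1 (fun s : R => a * cos (s / 2 - b) ^+ 2)
    (- (a * (cos (t / 2 - b) * sin (t / 2 - b)))).
Proof.
have dc := is_derive_cos_half b t.
have -> : (fun s : R => a * cos (s / 2 - b) ^+ 2) =
    a \*: ((fun s : R => cos (s / 2 - b)) ^+ 2) by [].
by apply: is_derive_eq; rewrite /GRing.scale /= ?fctE; field.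
Qed.

Lemma is_derive_cos_sin {R : realType} (a b t : R) :
  is_derive t 1 (fun s : R => - (a * (cos (s / 2 - b) * sin (s / 2 - b))))
    (- (a / 2 * (cos (t / 2 - b) ^+ 2 - sin (t / 2 - b) ^+ 2))).
Proof.
have dc := is_derive_cos_half b t; have ds := is_derive_sin_half b t.
have -> : (fun s : R => - (a * (cos (s / 2 - b) * sin (s / 2 - b)))) =
    (- a) \*: ((fun s : R => cos (s / 2 - b)) * (fun s : R => sin (s / 2 - b))).
  by apply/funext => s; rewrite /= -[in LHS]mulNr.
by apply: is_derive_eq; rewrite /GRing.scale /= ?fctE; field.
Qed.

Lemma derive1_cos2 {R : realType} (a b : R) :
  derive1 (fun s : R => a * cos (s / 2 - b) ^+ 2) =
  (fun s : R => - (a * (cos (s / 2 - b) * sin (s / 2 - b)))).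
Proof.
apply/funext => t; rewrite derive1E.
by have [_] := is_derive_cos2 a b t.
Qed.

(** * The curve without the arctangent *)

Lemma sin_atan {R : realType} (r : R) : sin (atan r) = r * cos (atan r).
Proof.
rewrite -{2}(atanK r) /tan divfK//.
by rewrite cos_atan invr_neq0// gt_eqF// sqrtr_gt0 ltr_wpDr ?sqr_ge0.
Qed.

Lemma cos_atan_sqr {R : realType} (r : R) :
  (1 + r ^+ 2) * cos (atan r) ^+ 2 = 1.
Proof. rewrite -[RHS](cos2Dsin2 (atan r)) sin_atan; ring. Qed.

(** The right-hand side shows what the polar form hides: for fixed t the
    curve is a quadratic form in f0 and g0, divided by f0. *)
Lemma curveE {R : realType} {X : Type} (f0 g0 : X -> R) (x : X) (t : R) :
  0 < f0 x ->
  curve f0 g0 x t = f0 x * (cos (t / 2) + g0 x / f0 x * sin (t / 2)) ^+ 2.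
Proof.
move=> f_gt0; have f_neq0 : f0 x != 0 by rewrite gt_eqF.
rewrite /curve /alpha.
set r := g0 x / f0 x; have -> : g0 x = r * f0 x by rewrite /r divfK.
have -> : beta f0 g0 x = atan r by [].
(* The factor (1 + r^2) cos^2 (atan r) = 1 is put on the right so that field
   need not know any trigonometry. *)
rewrite cosB sin_atan -[RHS]mulr1 -[X in _ = _ * X](cos_atan_sqr r).
field.
exact: f_neq0.
Qed.

(** * The initial value problem *)

Lemma curve_solves_ivp {R : realType} {X : Type} (f0 g0 : X -> R) (x : X) :
  0 < f0 x -> solves_ivp (f0 x) (g0 x) (curve f0 g0 x).
Proof.
move=> f_gt0; have f_neq0 : f0 x != 0 by rewrite gt_eqF.
set a := alpha f0 g0 x; set b := beta f0 g0 x.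
have y1 : derive1 (curve f0 g0 x) =
    fun t => - (a * (cos (t / 2 - b) * sin (t / 2 - b))).
  exact: derive1_cos2.
have y2 t : derive1 (derive1 (curve f0 g0 x)) t =
    - (a / 2 * (cos (t / 2 - b) ^+ 2 - sin (t / 2 - b) ^+ 2)).
  by rewrite y1 derive1E; have [_] := is_derive_cos_sin a b t.
split=> [t|t|t||].
- by have [] := is_derive_cos2 a b t.
- by rewrite y1; have [] := is_derive_cos_sin a b t.
- by rewrite y2 y1 /curve -/a -/b; field.
- by rewrite curveE// mul0r cos0 sin0 mulr0 addr0 expr1n mulr1.
- rewrite y1 mul0r sub0r cosN sinN mulrN mulrN opprK /a /alpha /b /beta.
  set r := g0 x / f0 x; have -> : g0 x = r * f0 x by rewrite /r divfK.
  by rewrite sin_atan -[RHS]mulr1 -[X in _ = _ * X](cos_atan_sqr r); field.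
Qed.

(** * The quotient y'^2 / y and its limits *)

(** At a zero of the cosine, cos (s/2 - b) is, up to a nonzero factor, the
    sine of (s - t)/2, which does not vanish for 0 < |s - t| < 2 pi; radius pi
    is ample. *)
Lemma cos_half_neq0_near {R : realType} (b t : R) : cos (t / 2 - b) = 0 ->
  \forall s \near t^', cos (s / 2 - b) != 0.
Proof.
move=> c0.
have s_neq0 : sin (t / 2 - b) != 0.
  apply/eqP => s0; have /eqP := cos2Dsin2 (t / 2 - b).
  by rewrite c0 s0 expr0n addr0 eq_sym oner_eq0.
near=> s.
have st : s != t by near: s; exact: nbhs_dnbhs_neq.
have /ltr_normlP [lt1 lt2] : `|t - s| < pi.
  by near: s; apply: nbhs_dnbhs; apply: nbhsx_ballx; exact: pi_gt0.
have -> : s / 2 - b = (t / 2 - b) + (s - t) / 2 by ring.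
rewrite cosD c0 mul0r sub0r oppr_eq0 mulf_neq0//.
have [lt_st|lt_ts|eq_st] := ltgtP s t; last by rewrite eq_st eqxx in st.
- have -> : (s - t) / 2 = - ((t - s) / 2) by ring.
  rewrite sinN oppr_eq0 gt_eqF// sin_gt0_pi//; have := pi_gt0 R; lra.
- rewrite gt_eqF// sin_gt0_pi//; have := pi_gt0 R; lra.
Unshelve. all: by end_near. Qed.

Lemma fisher_raw_cos2 {R : realType} (a b t : R)
    (y := fun s : R => a * cos (s / 2 - b) ^+ 2) :
  a != 0 -> cos (t / 2 - b) != 0 -> fisher_raw y t = a * sin (t / 2 - b) ^+ 2.
Proof.
move=> a0 c0; rewrite /fisher_raw derive1_cos2 /y; field.
by rewrite a0 c0.
Qed.

Lemma cvg_fisher_raw_cos2 {R : realType} (a b t : R)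
    (y := fun s : R => a * cos (s / 2 - b) ^+ 2) :
  a != 0 -> cos (t / 2 - b) = 0 ->
  fisher_raw y s @[s --> t^'] --> a * sin (t / 2 - b) ^+ 2.
Proof.
move=> a0 c0.
have near_eq : {near t^', (fun s : R => a * sin (s / 2 - b) ^+ 2) =1 fisher_raw y}.
  near=> s; rewrite /= fisher_raw_cos2//.
  by near: s; exact: cos_half_neq0_near.
apply: cvg_trans; first exact: (near_eq_cvg near_eq).
(* Shifting the phase by pi/2 turns the sine into the cosine, whose square
   is already known to be differentiable, hence continuous. *)
have -> : (fun s : R => a * sin (s / 2 - b) ^+ 2) =
    (fun s : R => a * cos (s / 2 - (b + pi / 2)) ^+ 2).
  by apply/funext => s; rewrite opprD addrA cosBpihalf.
have -> : sin (t / 2 - b) = cos (t / 2 - (b + pi / 2)).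
  by rewrite opprD addrA cosBpihalf.
have [/derivable1_diffP/differentiable_continuous cont _] :=
  is_derive_cos2 a (b + pi / 2) t.
by apply: cvg_trans cont; apply: cvg_app; exact: nbhs_dnbhs.
Unshelve. all: by end_near. Qed.

(** Extending by the limit makes the formula a sin^2 (t/2 - b) uniform in t: the
    zeros of the curve need no separate treatment under the integral. *)
Lemma fisher_cos2 {R : realType} (a b t : R)
    (y := fun s : R => a * cos (s / 2 - b) ^+ 2) :
  a != 0 -> fisher y t = a * sin (t / 2 - b) ^+ 2.
Proof.
move=> a0; rewrite /fisher {1}/y mulf_eq0 (negbTE a0) expf_eq0/=.
case: eqVneq => [c0|c_neq0]; last exact: fisher_raw_cos2.
by apply/cvg_lim => //; exact: cvg_fisher_raw_cos2.
Qed.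

(** * Integration *)

Lemma density_integrable {R : realType} {d : measure_display}
    {X : measurableType d} {mu : {measure set X -> \bar R}} {h : X -> R} :
  is_density mu h -> mu.-integrable [set: X] (EFin \o h).
Proof.
move=> [mh h0 h1]; apply/integrableP; split; first exact/measurable_EFinP.
under eq_integral do rewrite /= ger0_norm//.
by rewrite h1 ltry.
Qed.

(** On positive reals the inverse is the power with exponent -1, and real
    powers are measurable. *)
Lemma measurable_inv_pos {R : realType} {d : measure_display}
    {X : measurableType d} {h : X -> R} :
  (forall x, 0 < h x) -> measurable_fun [set: X] h ->
  measurable_fun [set: X] (fun x => (h x)^-1).
Proof.
move=> h0 mh.
have -> : (fun x => (h x)^-1) = (@powR R ^~ (-1)) \o h.
  by apply/funext => x /=; rewrite powR_inv1// ltW.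
exact: measurableT_comp.
Qed.

(** Multiplying out the square leaves p^2 f + 2 p q g + q^2 (g^2/f); the cross
    term integrates to 0 and the outer two to p^2 + q^2. *)
Lemma density_square_combination {R : realType} (d : measure_display)
    (X : measurableType d) (mu : {measure set X -> \bar R}) (f g : X -> R)
    (p q : R) :
  (forall x, 0 < f x) -> is_density mu f ->
  mu.-integrable [set: X] (EFin \o g) ->
  (\int[mu]_(x in [set: X]) (g x)%:E = 0)%E ->
  (\int[mu]_(x in [set: X]) (g x ^+ 2 / f x)%:E = 1)%E ->
  p ^+ 2 + q ^+ 2 = 1 ->
  is_density mu (fun x => f x * (p + g x / f x * q) ^+ 2).
Proof.
move=> f_gt0 df ig g_int g2_int pq1.
have [mf f_ge0 f_int] := df.
have mg : measurable_fun [set: X] g.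
  by move/integrableP : ig => [/measurable_EFinP].
have mV := measurable_inv_pos f_gt0 mf.
have dg : is_density mu (fun x => g x ^+ 2 / f x).
  split=> //; first by apply: measurable_funM => //; exact: measurable_funX.
  by move=> x; rewrite divr_ge0 ?sqr_ge0// ltW.
have i_f := density_integrable df.
have i_g2 := density_integrable dg.
split.
- apply: measurable_funM => //; apply: measurable_funX.
  apply: measurable_funD => //; apply: measurable_funM => //.
  exact: measurable_funM.
- by move=> x; rewrite mulr_ge0// sqr_ge0.
- transitivity (\int[mu]_x ((p ^+ 2)%:E * (f x)%:E +
      ((2 * p * q)%:E * (g x)%:E + (q ^+ 2)%:E * (g x ^+ 2 / f x)%:E)))%E.
    apply: eq_integral => x _; congr (_%:E) => /=.
    by field; rewrite gt_eqF.
  rewrite integralD//=; last 2 first.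
  + exact: integrableZl.
  + by apply: integrableD => //; exact: integrableZl.
  rewrite integralD//=; last 2 first.
  + exact: integrableZl.
  + exact: integrableZl.
  rewrite !integralZl// f_int g_int g2_int.
  by rewrite mule0 add0e !mule1 -EFinD pq1.
Qed.

(** * The statistical curve *)

Theorem theorem4p2 (R : realType) (d : measure_display) (X : measurableType d)
    (mu : {sigma_finite_measure set X -> \bar R}) (f0 g0 : X -> R)
    (f0_density : is_density mu f0)
    (f0_pos : forall x : X, 0 < f0 x)
    (g0_integrable : mu.-integrable [set: X] (fun x => (g0 x)%:E))
    (g0_int : (\int[mu]_(x in [set: X]) (g0 x)%:E = 0)%E)
    (g0_sq_int : (\int[mu]_(x in [set: X]) (g0 x ^+ 2 / f0 x)%:E = 1)%E) :
  [/\ (* (i) *)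
      (forall x : X, solves_ivp (f0 x) (g0 x) (curve f0 g0 x)),
      (* (ii) *)
      (forall t : R, is_density mu (fun x => curve f0 g0 x t)) &
      (* (iii), with the quotient well defined at the zeros of the curve *)
      (forall (x : X) (t : R), curve f0 g0 x t = 0 ->
         cvg (fisher_raw (curve f0 g0 x) s @[s --> t^'])) /\
      (forall t : R, is_density mu (fun x => fisher (curve f0 g0 x) t))].
Proof.
have alpha_neq0 x : alpha f0 g0 x != 0.
  by rewrite gt_eqF// divr_gt0// ltr_wpDr ?sqr_ge0// exprn_gt0.
have density t : is_density mu (fun x => curve f0 g0 x t).
  under eq_fun do rewrite curveE//.
  by apply: density_square_combination => //; exact: cos2Dsin2.
split=> //; first by move=> x; exact: curve_solves_ivp.
split=> [x t /eqP|t].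
  rewrite mulf_eq0 (negbTE (alpha_neq0 x)) expf_eq0/= => /eqP c0.
  by apply: cvgP; exact: (cvg_fisher_raw_cos2 _ _ _ (alpha_neq0 x) c0).
(* Time t + pi moves the phase by a quarter turn. *)
have -> : (fun x => fisher (curve f0 g0 x) t) = (fun x => curve f0 g0 x (t + pi)).
  apply/funext => x; rewrite fisher_cos2// /curve.
  have -> : (t + pi) / 2 - beta f0 g0 x = t / 2 - beta f0 g0 x + pi / 2 by ring.
  by rewrite cosDpihalf sqrrN.
exact: density.
Qed.
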